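(* Let $H$ be Hall's universal locally finite group. Then the group $Aut(H)$ is complete, i.e. $Aut(H)$ has trivial center and every automorphism of the group $Aut(H)$ is inner.
   Context: Hall's universal locally finite group $H$ is the group, unique up to isomorphism, such that: (A) $H$ is countable; (B) $H$ is locally finite (every finitely generated subgroup is finite); (C) every finite group embeds into $H$; (D) any two isomorphic finite subgroups of $H$ are conjugate in $H$. $Aut(H)$ denotes the group of all automorphisms of $H$. *)

(* Defs.v *)
From HB Require Import structures.
From mathcomp Require Import all_boot fingroup.
From mathcomp Require Import boolp classical_sets functions cardinality.

Set Implicit Arguments.
Unset Strict Implicit.
Unset Printing Implicit Defensive.

Local Open Scope classical_set_scope.
Local Open Scope group_scope.

Record groupAut (G : groupType) := GroupAut {
  aut_fun :> G -> G;
  aut_morph : {morph aut_fun : x y / x * y};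
  aut_bij : bijective aut_fun
}.

HB.instance Definition _ (G : groupType) := gen_eqMixin (groupAut G).
HB.instance Definition _ (G : groupType) := gen_choiceMixin (groupAut G).
HB.instance Definition _ (G : groupType) (f : groupAut G) :=
  isMultiplicative.Build G G f (@aut_morph G f).

Lemma groupAut_ext (G : groupType) (f g : groupAut G) : f =1 g -> f = g.
Proof.
case: f g => [f fM fB] [g gM gB] /= /funext fg.
rewrite fg in fM fB *.
by rewrite (Prop_irrelevance fM gM) (Prop_irrelevance fB gB).
Qed.

Section AutGroup.
Variable G : groupType.
Implicit Types f g : groupAut G.

Definition groupAut1 : groupAut G :=
  @GroupAut G idfun (fun _ _ => erefl)
    (Bijective (fun=> erefl) (fun=> erefl)).

Lemma groupAut_comp_morph f g : {morph f \o g : x y / x * y}.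
Proof. by move=> x y; rewrite /= !aut_morph. Qed.

Definition groupAut_mul f g : groupAut G :=
  GroupAut (groupAut_comp_morph f g) (bij_comp (aut_bij f) (aut_bij g)).

Lemma groupAut_inv_ex f : exists h : G -> G, cancel f h /\ cancel h f.
Proof. by case: (aut_bij f) => h; exists h. Qed.

Definition groupAut_inv_fun f : G -> G := projT1 (cid (groupAut_inv_ex f)).

Lemma groupAut_funK f : cancel f (groupAut_inv_fun f).
Proof. by rewrite /groupAut_inv_fun; case: cid => h []. Qed.

Lemma groupAut_inv_funK f : cancel (groupAut_inv_fun f) f.
Proof. by rewrite /groupAut_inv_fun; case: cid => h []. Qed.

Lemma groupAut_inv_morph f : {morph groupAut_inv_fun f : x y / x * y}.
Proof.
exact: (can2_gmulfM (f := f) (@groupAut_funK f) (@groupAut_inv_funK f)).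
Qed.

Definition groupAut_inv f : groupAut G :=
  GroupAut (groupAut_inv_morph f)
    (Bijective (@groupAut_inv_funK f) (@groupAut_funK f)).

Lemma groupAut_mulA : associative groupAut_mul.
Proof. by move=> f g h; exact: groupAut_ext. Qed.

Lemma groupAut_mul1 : left_id groupAut1 groupAut_mul.
Proof. by move=> f; exact: groupAut_ext. Qed.

Lemma groupAut_mulr1 : right_id groupAut1 groupAut_mul.
Proof. by move=> f; exact: groupAut_ext. Qed.

Lemma groupAut_mulV : left_inverse groupAut1 groupAut_inv groupAut_mul.
Proof. by move=> f; apply: groupAut_ext => x /=; rewrite groupAut_funK. Qed.

Lemma groupAut_mulrV : right_inverse groupAut1 groupAut_inv groupAut_mul.
Proof. by move=> f; apply: groupAut_ext => x /=; rewrite groupAut_inv_funK. Qed.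

HB.instance Definition _ := isGroup.Build (groupAut G)
  groupAut_mulA groupAut_mul1 groupAut_mulr1 groupAut_mulV groupAut_mulrV.

End AutGroup.

Section GroupNotions.
Variable G : groupType.

Definition is_subgroup (A : set G) : Prop :=
  A 1 /\ forall x y, A x -> A y -> A (x / y).

Definition subgroup_gen (X : set G) : set G := smallest is_subgroup X.

Definition locally_finite : Prop :=
  forall X : set G, finite_set X -> finite_set (subgroup_gen X).

(* The isomorphism is a total function on G, of which only the restriction
   to A matters. *)
Definition isom_subgroups (A B : set G) : Prop :=
  exists f : G -> G,
    set_bij A B f /\ forall x y, A x -> A y -> f (x * y) = f x * f y.

Definition conj_subgroups (A B : set G) : Prop :=
  exists g : G, B = [set x ^ g | x in A].

Definition group_center : set G := [set z | forall x, commute z x].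

Definition inner_aut (phi : groupAut G) : Prop :=
  exists g : G, forall x, phi x = x ^ g.

Definition complete_group : Prop :=
  group_center = [set 1] /\ forall phi : groupAut G, inner_aut phi.

Definition embeds (K : groupType) : Prop :=
  exists f : {multiplicative K -> G}, injective f.

(* [countable] allows finite sets, but the third clause makes G infinite. *)
Definition Hall_universal : Prop :=
  [/\ countable [set: G],
      locally_finite,
      forall K : finGroupType, embeds K
    & forall A B : set G,
        is_subgroup A -> is_subgroup B -> finite_set A -> finite_set B ->
        isom_subgroups A B -> conj_subgroups A B].

End GroupNotions.

Arguments locally_finite : clear implicits.
Arguments complete_group : clear implicits.
Arguments Hall_universal : clear implicits.
Arguments embeds : clear implicits.
Arguments group_center : clear implicits.

(* Main.v *)
From HB Require Import structures.
Require Import Defs.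
From mathcomp Require Import all_boot fingroup.
From mathcomp Require Import ssralg zmodp perm.
From mathcomp Require Import boolp classical_sets cardinality.

(** Burnside observed that the automorphism group of any nonabelian simple group
    is complete, and Hall's group [H] is simple; the theorem combines these two
    facts.

    Completeness of [Aut G] for [G] nonabelian simple ([simple_complete]).  The
    centre of [G] is trivial, so [g |-> inner g] embeds [G] into [Aut G], and
    [f (inner g) f^-1 = inner (f g)].  A nontrivial automorphism [f] moves some
    [g], so a normal subgroup containing [f] contains the nontrivial inner
    automorphism [inner (g / f g)], hence, [G] being simple, all of them.  Thus
    the inner automorphisms form the least nontrivial normal subgroup of
    [Aut G], and every automorphism [phi] of [Aut G] preserves them:
    [phi (inner g) = inner (a g)] for some automorphism [a] of [G].  Applying
    [phi] to [f (inner g) f^-1 = inner (f g)] gives [phi f \o a = a \o f], that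
    is, [phi] is conjugation by [a].

    Simplicity of [H] ([Hall_simple]).  Elements of the same finite order
    generate isomorphic, hence conjugate, cyclic subgroups, so a normal subgroup
    containing one of them contains the other.  For all [n, m > 1] some finite
    group, and therefore [H], contains [t] of order [n] and [g] such that
    [[~ t, g]] has order [m] ([commutator_of_orders]).  A normal subgroup with
    an element of order [n > 1] then contains such a [t], hence [[~ t, g]], hence
    every element of order [m]. *)

Set Implicit Arguments.
Unset Strict Implicit.
Unset Printing Implicit Defensive.

Import GRing.Theory.

Local Open Scope classical_set_scope.
Local Open Scope group_scope.

(** * Normal subgroups and simple groups *)

Section NormalSubgroups.
Variable G : groupType.
Implicit Types (x y g : G) (N : set G).

Definition normal_subgroup N : Prop :=
  is_subgroup N /\ forall x g, N x -> N (x ^ g).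

Definition nonabelian_simple : Prop :=
  (exists x y : G, ~ commute x y) /\
  forall N, normal_subgroup N -> forall x, N x -> x <> 1 -> forall y, N y.

End NormalSubgroups.

Section NormalSubgroupTheory.
Variable G : groupType.
Implicit Types (x y g : G) (N : set G).

Lemma subgroupV N x : is_subgroup N -> N x -> N x^-1.
Proof. by case=> N1 NV Nx; rewrite -[x^-1]mul1g; apply: NV. Qed.

Lemma subgroupM N x y : is_subgroup N -> N x -> N y -> N (x * y).
Proof.
move=> sN Nx Ny; rewrite -[y]invgK.
by case: (sN) => _; apply=> //; apply: subgroupV.
Qed.

Lemma normal_subgroupR N x g : normal_subgroup N -> N x -> N [~ x, g].
Proof.
by case=> sN NJ Nx; apply: subgroupM => //; [exact: subgroupV|exact: NJ].
Qed.

Lemma normal_subgroup_preim (K : groupType) (f : UMagmaMorphism.type G K)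
  (N : set K) : normal_subgroup N -> normal_subgroup (f @^-1` N).
Proof.
case=> -[N1 NV] NJ; split; first split=> [|x y] /=.
- by rewrite gmulf1.
- by rewrite gmulfF; exact: NV.
- by move=> x g /=; rewrite gmulfJ; exact: NJ.
Qed.

Lemma normal_center : normal_subgroup (group_center G).
Proof.
split; first split=> [y|x y Zx Zy z]; first exact/commute_sym/commute1.
  by apply/commute_sym/commuteM; [|apply: commuteV]; apply: commute_sym.
by move=> x g Zx; suff -> : x ^ g = x by []; apply/conjg_fixP/commgP/Zx.
Qed.

(** The centre is normal, so if it were nontrivial it would be all of [G]. *)
Lemma simple_center : nonabelian_simple G -> group_center G = [set 1].
Proof.
case=> -[a [b nab]] sG; apply/seteqP; split=> [z Zz|_ ->].
  apply: contrapT => /(sG _ normal_center _ Zz) ZG.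
  by apply: nab; apply: ZG.
by case: normal_center => -[].
Qed.

End NormalSubgroupTheory.

(** * The automorphism group of a nonabelian simple group *)

Lemma multiplicative1 (G K : groupType) (f : {multiplicative G -> K}) :
  f 1 = 1.
Proof. by apply: (mulgI (f 1)); rewrite -gmulfM !mulg1. Qed.

(** The theory of morphisms preserving units and inverses is stated for
    [UMagmaMorphism.type]; between groups, multiplicativity suffices to enter
    it. *)
Definition group_morphism (G K : groupType) (f : {multiplicative G -> K}) :
    UMagmaMorphism.type G K :=
  HB.pack (Multiplicative.sort f)
    (Multiplicative_isUMagmaMorphism.Build G K f (multiplicative1 f)).

HB.instance Definition _ (G : groupType) (f : groupAut G) :=
  Multiplicative_isUMagmaMorphism.Build G G f (multiplicative1 f).

Section InnerAutomorphisms.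
Variable G : groupType.
Implicit Types (g x y : G) (f : groupAut G).

Lemma conjgV_morph g : {morph (fun x => x ^ g^-1) : x y / x * y}.
Proof. by move=> x y; rewrite conjMg. Qed.

(** Conjugation by [g^-1], and not by [g], because products in [groupAut G] are
    compositions [f \o g] while [x ^ (g * h) = (x ^ g) ^ h]: this choice makes
    [inner] a morphism. *)
Definition inner g : groupAut G :=
  GroupAut (conjgV_morph g) (Bijective (@conjgKV G g) (@conjgK G g)).

Lemma innerM : {morph inner : g h / g * h}.
Proof. by move=> g h; apply: groupAut_ext => x /=; rewrite invMg conjgM. Qed.

HB.instance Definition _ := isMultiplicative.Build G (groupAut G) inner innerM.
HB.instance Definition _ := Multiplicative_isUMagmaMorphism.Build
  G (groupAut G) inner (multiplicative1 inner).

Lemma innerJ f g : inner g ^ f^-1 = inner (f g).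
Proof.
rewrite /conjg invgK mulgA; apply: canLR (mulgK _) _.
apply: groupAut_ext => x /=.
by rewrite gmulfJ gmulfV.
Qed.

Lemma inner_inj : group_center G = [set 1] -> injective inner.
Proof.
move=> Z1; apply: gmulf_inj => g g1.
suff : group_center G g by rewrite Z1.
move=> x; apply/commute_sym; rewrite /commute [RHS]conjgCV.
by rewrite [x ^ _](_ : _ = inner g x) // g1.
Qed.

(** If [f] moves [g], the commutator of [inner g] and [f] is a nontrivial inner
    automorphism in [N]; the preimage of [N] under [inner] is then a nontrivial
    normal subgroup of [G]. *)
Lemma inner_sub_normal (N : set (groupAut G)) f :
  nonabelian_simple G -> normal_subgroup N -> N f -> f <> 1 ->
  forall g, N (inner g).
Proof.
move=> sG nN Nf f1.
have [g fg] : exists g, f g <> g.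
  by apply/existsNP => fid; apply: f1; apply: groupAut_ext.
have Nfg : N (inner (g / f g)).
  rewrite innerM gmulfV /= -innerJ.
  have -> : inner g / inner g ^ f^-1 = [~ (inner g)^-1, f^-1].
    by rewrite /commg invgK conjVg.
  rewrite -invgR; apply: subgroupV; first by case: nN.
  apply: normal_subgroupR => //.
  by apply: subgroupV Nf; case: nN.
apply: (sG.2 (inner @^-1` N) _ _ Nfg); first exact: normal_subgroup_preim.
by move=> /divg1_eq/esym.
Qed.

(** The preimage under [phi] of the subgroup of inner automorphisms is normal and
    nontrivial, so it contains every inner automorphism. *)
Lemma aut_preserves_inner (phi : groupAut (groupAut G)) g :
  nonabelian_simple G -> exists h, phi (inner g) = inner h.
Proof.
move=> sG; have [[a [b nab]] _] := sG.
have Z1 := simple_center sG.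
pose I : set (groupAut G) := [set inner h | h in [set: G]].
have nI : normal_subgroup I.
  split; first split.
  - by exists 1; rewrite ?gmulf1.
  - by move=> _ _ [h _ <-] [k _ <-]; exists (h / k); rewrite ?gmulfF.
  - by move=> _ f [h _ <-]; exists (f^-1 h); rewrite // -innerJ invgK.
have a1 : inner a <> 1.
  rewrite -(multiplicative1 inner) => /(inner_inj Z1) a1; apply: nab.
  by rewrite a1; apply/commute_sym/commute1.
have [psi psiK phiK] := aut_bij phi.
have psiI : phi (psi (inner a)) = inner a by exact: phiK.
have psi1 : psi (inner a) <> 1.
  by move=> E; move: psiI; rewrite E gmulf1 => /esym.
have I' : (phi @^-1` I) (psi (inner a)) by rewrite /= psiI; exists a.
have [h _ <-] := inner_sub_normal sG (normal_subgroup_preim phi nI) I' psi1 g.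
by exists h.
Qed.

(** Burnside's theorem. *)
Theorem simple_complete : nonabelian_simple G -> complete_group (groupAut G).
Proof.
move=> sG; have Z1 := simple_center sG; have iI := inner_inj Z1; split.
  apply/seteqP; split=> [z Zz|_ ->]; last first.
    by case: (normal_center (groupAut G)) => -[].
  apply: groupAut_ext => g; apply: iI.
  by rewrite -innerJ; apply/conjg_fixP/commgP/commuteV/commute_sym.
move=> phi.
pose a g := projT1 (cid (aut_preserves_inner phi g sG)).
have aE g : phi (inner g) = inner (a g) by rewrite /a; case: cid.
have aM : {morph a : g h / g * h}.
  by move=> g h; apply: iI; rewrite innerM -!aE -gmulfM innerM.
(* The same construction for [phi^-1] inverts [a]. *)
pose b g := projT1 (cid (aut_preserves_inner phi^-1 g sG)).
have bE g : phi^-1 (inner g) = inner (b g) by rewrite /b; case: cid.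
have aK : cancel a b.
  by move=> g; apply: iI; rewrite -bE -aE; exact: groupAut_funK.
have bK : cancel b a.
  by move=> g; apply: iI; rewrite -aE -bE; exact: groupAut_inv_funK.
pose alpha := GroupAut aM (Bijective aK bK).
exists alpha^-1 => f; rewrite /conjg invgK mulgA.
apply: canRL (mulgK _) _; apply: groupAut_ext => g; apply: iI.
rewrite -[RHS]/(inner (a (f g))) -aE -(innerJ f) gmulfJ gmulfV.
by rewrite /= aE innerJ.
Qed.

End InnerAutomorphisms.

(** * Orders of elements and cyclic subgroups *)

Section Orders.
Implicit Types G K : groupType.

(** Infinite order is the case [n = 0]. *)
Definition has_order G (x : G) n := forall k, x ^+ k = 1 <-> n %| k.

Lemma has_order_gt1 G (x : G) n : 0 < n -> has_order x n -> x <> 1 -> 1 < n.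
Proof.
move=> n0 ox x1; rewrite ltn_neqAle n0 andbT eq_sym.
by apply/eqP => n1; apply: x1; rewrite -[x]expg1; apply/ox; rewrite n1.
Qed.

Lemma has_order_inj G K (f : UMagmaMorphism.type G K) x n :
  injective f -> has_order x n -> has_order (f x) n.
Proof.
move=> fI ox k; rewrite -gmulfXn -ox; split=> [|->]; last exact: gmulf1.
by rewrite -(gmulf1 (s:=f)) => /fI.
Qed.

Lemma expg_eq_order G K (x : G) (y : K) n i j :
  has_order x n -> has_order y n -> x ^+ i = x ^+ j -> y ^+ i = y ^+ j.
Proof.
move=> ox oy; wlog ij : i j / i <= j => [wl|].
  by case/orP: (leq_total i j) => ij; [|move/esym => E; apply/esym; move: E];
     exact: wl.
rewrite -(subnKC ij) !expgnDr -{1}[x ^+ i]mulg1 => /mulgI/esym/ox/oy ->.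
by rewrite mulg1.
Qed.

Definition powers G (x : G) : set G := [set x ^+ k | k in [set: nat]].

Lemma powers_sub_gen G (x : G) : powers x `<=` subgroup_gen [set x].
Proof.
move=> _ [k _ <-] A /= [sA /(_ x erefl) Ax].
elim: k => [|k IHk]; first by case: sA.
by rewrite expgS; apply: subgroupM.
Qed.

Lemma finite_powers G (x : G) : locally_finite G -> finite_set (powers x).
Proof.
by move=> lfG; apply: sub_finite_set (@powers_sub_gen _ x) (lfG _ _).
Qed.

(** Otherwise [k |-> x ^+ k] would inject the natural numbers into a finite
    subgroup. *)
Lemma locally_finite_order G (x : G) :
  locally_finite G -> exists2 n, 0 < n & has_order x n.
Proof.
move=> lfG.
have [k k0 xk] : exists2 k, 0 < k & x ^+ k == 1.
  apply: contrapT => no_k; apply: infinite_nat.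
  rewrite (_ : setT = natexp x @^-1` powers x); last first.
    by apply/seteqP; split=> // k _; exists k.
  apply: finite_preimage (finite_powers _ lfG) => i j _ _ /= xij.
  wlog ij : i j xij / i < j => [wl|].
    by case: (ltngtP i j) => // ij; [|apply/esym]; exact: wl.
  exfalso; apply: no_k; exists (j - i); first by rewrite subn_gt0.
  by rewrite expgnFr ?(ltnW ij)// xij mulgV.
have exn : exists k, (0 < k) && (x ^+ k == 1) by exists k; rewrite k0.
case: (ex_minnP exn) => n /andP[n0 /eqP xn] n_min; exists n => // i; split.
  rewrite {1}(divn_eq i n) expgnDr mulnC expgnA xn expg1n mul1g => /eqP xr.
  apply: contraT; rewrite /dvdn -lt0n => r0.
  have := n_min (i %% n); rewrite r0 xr => /(_ isT).
  by rewrite leqNgt ltn_pmod.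
by case/dvdnP => q ->; rewrite mulnC expgnA xn expg1n.
Qed.

Lemma subgroup_powers G (x : G) n :
  0 < n -> has_order x n -> is_subgroup (powers x).
Proof.
move=> n0 ox; split=> [|_ _ [i _ <-] [j _ <-]]; first by exists 0.
(* Modulo [n], the exponent [j * n.-1] is [- j]. *)
exists (i + j * n.-1) => //.
rewrite expgnDr; congr (_ * _).
rewrite -[RHS]mulg1 -{1}(_ : x ^+ (j * n) = 1); last exact/ox/dvdn_mull.
by rewrite -{2}(prednK n0) mulnS expgnDr mulKg.
Qed.

(** The map [x ^+ i |-> y ^+ i] is well defined and injective since both sides
    depend exactly on the class of [i] modulo the common order. *)
Lemma isom_powers G (x y : G) n :
  has_order x n -> has_order y n -> isom_subgroups (powers x) (powers y).
Proof.
move=> ox oy.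
(* [e z] is an exponent of [z] as a power of [x]; off [powers x] it is
   arbitrary. *)
have /choice [e eP] : forall z, exists i, powers x z -> z = x ^+ i.
  by move=> z; have [[i _ <-]|nz] := pselect (powers x z); [exists i|exists 0].
have fE i : y ^+ e (x ^+ i) = y ^+ i.
  by apply: expg_eq_order ox oy _; rewrite -eP //; exists i.
exists (fun z => y ^+ e z); split; first split.
- by move=> _ [i _ <-]; rewrite fE; exists i.
- move=> _ _ /set_mem[i _ <-] /set_mem[j _ <-]; rewrite !fE.
  exact: expg_eq_order oy ox.
- by move=> _ [i _ <-]; exists (x ^+ i); [exists i|rewrite fE].
- by move=> _ _ [i _ <-] [j _ <-]; rewrite -expgnDr !fE expgnDr.
Qed.

End Orders.

(** * Commutators of prescribed order in a finite group *)

(** On the torus [Z/(n+2) * Z/(m+2)], the rotation [rot] of the first coordinate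
    has order [n+2].  Its commutator with a permutation translating each fibre
    [{i} * Z/(m+2)] by [u i] again translates each fibre, now by
    [u i - u (i - 1)].  For [u] the indicator of [0], the fibre over [0] is
    translated by [1], because [0 - 1 <> 0] modulo [n+2]; the commutator
    therefore has order [m+2]. *)
Section CommutatorOrder.
Variables n m : nat.
Local Notation T := ('I_n.+2 * 'I_m.+2)%type.
Local Open Scope ring_scope.

Definition rot_fun (p : T) : T := (p.1 + 1, p.2).
Lemma rot_fun_inj : injective rot_fun.
Proof. by move=> [i j] [i' j'] /pair_equal_spec[/addIr /= -> ->]. Qed.
Definition rot : {perm T} := perm rot_fun_inj.

Definition shear_fun (u : 'I_n.+2 -> 'I_m.+2) (p : T) : T := (p.1, p.2 + u p.1).
Lemma shear_fun_inj u : injective (shear_fun u).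
Proof. by move=> [i j] [i' j'] /pair_equal_spec[/= -> /addIr->]. Qed.
Definition shear u : {perm T} := perm (@shear_fun_inj u).

Lemma rotX k i j : (rot ^+ k)%g (i, j) = (i + k%:R, j).
Proof.
elim: k => [|k IHk]; first by rewrite expg0 perm1 addr0.
by rewrite expgSr permM IHk permE /rot_fun /= -addrA natr1.
Qed.

Lemma shearX u k i j : (shear u ^+ k)%g (i, j) = (i, j + u i *+ k).
Proof.
elim: k => [|k IHk]; first by rewrite expg0 perm1 addr0.
by rewrite expgSr permM IHk permE /shear_fun /= -addrA -mulrSr.
Qed.

Lemma commg_rot_shear u :
  [~ rot, shear u]%g = shear (fun i => u i - u (i - 1)).
Proof.
apply/permP => -[i j]; rewrite /commg /conjg !permM.
have -> : rot^-1%g (i, j) = (i - 1, j).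
  by apply: canLR (permK _) _; rewrite permE /rot_fun /= subrK.
have -> : (shear u)^-1%g (i - 1, j) = (i - 1, j - u (i - 1)).
  by apply: canLR (permK _) _; rewrite permE /shear_fun /= subrK.
by rewrite !permE /shear_fun /rot_fun /= subrK addrAC addrA.
Qed.

Lemma Zp_natr_eq0 p k : (k%:R == 0 :> 'I_p.+2) = (p.+2 %| k)%N.
Proof. by rewrite -val_eqE /= (@val_Zp_nat p.+2). Qed.

Lemma has_order_rot : has_order rot n.+2.
Proof.
move=> k; rewrite -Zp_natr_eq0; split=> [/permP/(_ (0, 0))|/eqP k0].
  by rewrite rotX perm1 add0r => -[->].
by apply/permP => -[i j]; rewrite rotX perm1 k0 addr0.
Qed.

Lemma has_order_commg_shear :
  has_order [~ rot, shear (fun i => (i == 0)%:R)]%g m.+2.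
Proof.
move=> k; rewrite commg_rot_shear -Zp_natr_eq0.
split=> [/permP/(_ (0, 0))|/eqP k0].
  by rewrite shearX perm1 eqxx !add0r oppr_eq0 oner_eq0 subr0 => -[->].
apply/permP => -[i j]; rewrite shearX perm1.
by rewrite -[X in _ + X]mulr_natr k0 mulr0 addr0.
Qed.

End CommutatorOrder.

Lemma commutator_of_orders n m : 1 < n -> 1 < m ->
  exists (K : finGroupType) (t g : K), has_order t n /\ has_order [~ t, g] m.
Proof.
case: n => [|[|n]] // _; case: m => [|[|m]] // _.
exists {perm 'I_n.+2 * 'I_m.+2}, (rot n m), (shear (fun i => (i == 0)%:R)%R).
by split; [exact: has_order_rot|exact: has_order_commg_shear].
Qed.

(** * Simplicity of Hall's universal group *)

Section HallGroup.
Variable H : groupType.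
Hypothesis hH : Hall_universal H.

Lemma Hall_commutator_of_orders n m : 1 < n -> 1 < m ->
  exists t g : H, has_order t n /\ has_order [~ t, g] m.
Proof.
move=> n1 m1; have [K [t [g [ot oc]]]] := commutator_of_orders n1 m1.
have [_ _ emb _] := hH; have [h hI] := emb K.
pose f := group_morphism h.
have fI : injective f by [].
exists (f t), (f g); rewrite -gmulfR.
by split; exact: has_order_inj.
Qed.

(** The conjugation carrying [<x>] to [<y>] is only known to match these as
    sets, and need not send [x] to [y]; but [y] is then conjugate to a power of
    [x], which is enough. *)
Lemma Hall_normal_same_order (N : set H) x y n : normal_subgroup N ->
  0 < n -> has_order x n -> has_order y n -> N x -> N y.
Proof.
move=> [sN NJ] n0 ox oy Nx; have [_ lfH _ conjH] := hH.
have [g yE] := conjH _ _ (subgroup_powers n0 ox) (subgroup_powers n0 oy)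
  (finite_powers x lfH) (finite_powers y lfH) (isom_powers ox oy).
have : powers y y by exists 1%N; rewrite ?expg1.
rewrite yE => -[_ [k _ <-] <-]; apply: NJ.
elim: k => [|k IHk]; first by case: sN.
by rewrite expgS; apply: subgroupM.
Qed.

Theorem Hall_simple : nonabelian_simple H.
Proof.
have [_ lfH _ _] := hH; split.
  (* A commutator of order 2 is nontrivial. *)
  have [t [g [_ oc]]] := @Hall_commutator_of_orders 2 2 isT isT.
  exists t, g => /commgP/eqP c1.
  by have := (oc 1%N).1; rewrite expg1 c1 => /(_ erefl).
move=> N nN x Nx x1 y.
have [->|/eqP y1] := eqVneq y 1; first by case: nN => -[].
have [n n0 ox] := locally_finite_order x lfH.
have [m m0 oy] := locally_finite_order y lfH.
have [t [g [ot oc]]] := Hall_commutator_of_orders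
  (has_order_gt1 n0 ox x1) (has_order_gt1 m0 oy y1).
apply: (Hall_normal_same_order nN m0 oc oy).
apply: normal_subgroupR => //.
exact: (Hall_normal_same_order nN n0 ox ot Nx).
Qed.

End HallGroup.

Theorem theorem2 (H : groupType) (hH : Hall_universal H) :
  complete_group (groupAut H).
Proof. exact/simple_complete/Hall_simple. Qed.
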